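(* For all $\alpha,\beta\in\mathrm{ASP}$, the following three minima in Bruhat order exist, and all are equal to $\alpha\triangleleft\beta^{-1}$: $$\alpha\triangleleft\beta^{-1}=\min\{\alpha_1\beta_1^{-1}:\ \alpha_1,\beta_1\in\mathrm{ASP},\ \alpha_1\ge\alpha,\ \beta_1\le\beta\}$$ $$=\min\{\alpha\beta_1^{-1}:\ \beta_1\in\mathrm{ASP},\ \beta_1\le_\chi\beta\}$$ $$=\min\{\alpha_1\beta^{-1}:\ \alpha_1\in\mathrm{ASP},\ \alpha_1\ge_\chi\alpha\}.$$
   Context: A permutation means a bijection $\mathbb{Z}\to\mathbb{Z}$; products of permutations are compositions. $\mathrm{ASP}$ is the group of permutations $\alpha$ for which only finitely many $n\in\mathbb{Z}$ have exactly one of $n,\alpha(n)$ negative. For $\alpha\in\mathrm{ASP}$, $s_\alpha(a,b)=\#\{n\ge b:\ \alpha(n)<a\}$ for $a,b\in\mathbb{Z}$ (always finite; $s_\alpha$ determines $\alpha$). The shift of $\alpha$ is $\chi_\alpha=s_\alpha(0,0)-s_{\alpha^{-1}}(0,0)$. Bruhat order on $\mathrm{ASP}$: $\alpha\le\beta$ means $s_\alpha(a,b)\le s_\beta(a,b)$ for all $a,b\in\mathbb{Z}$. Write $\alpha\le_\chi\beta$ (equivalently $\beta\ge_\chi\alpha$) if $\alpha\le\beta$ and $\chi_\alpha=\chi_\beta$. The left residual $\alpha\triangleleft\beta$ is the unique element of $\mathrm{ASP}$ such that $s_{\alpha\triangleleft\beta}(a,b)=\max_{\ell\in\mathbb{Z}}[s_\alpha(a,\ell)-s_{\beta^{-1}}(b,\ell)]$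 for all $a,b\in\mathbb{Z}$ (such an element always exists). *)

(* Defs.v *)
From HB Require Import structures.
From mathcomp Require Import all_boot all_order all_algebra.
From mathcomp Require Import finmap.
From mathcomp Require Import boolp classical_sets functions cardinality.
From mathcomp Require Import zify.
Set Implicit Arguments.
Unset Strict Implicit.
Unset Printing Implicit Defensive.
Import Order.TTheory GRing.Theory Num.Theory.
Local Open Scope classical_set_scope.
Local Open Scope ring_scope.

Definition sign_changes (f : int -> int) : set int :=
  [set n : int | (n < 0) != (f n < 0)].

(* Almost sign-preserving permutations of the integers. *)
Record ASP := MkASP {
  asp_fun :> int -> int;
  asp_bij : bijective asp_fun;
  asp_sign : finite_set (sign_changes asp_fun) }.

HB.instance Definition _ := gen_eqMixin ASP.
HB.instance Definition _ := gen_choiceMixin ASP.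

Lemma asp_ext (alpha beta : ASP) : alpha =1 beta -> alpha = beta.
Proof.
case: alpha beta => [f bf sf] [g bg sg] /= /funext fg.
by subst g; congr MkASP; exact: Prop_irrelevance.
Qed.

Lemma asp_one_sign : finite_set (sign_changes id).
Proof.
rewrite (_ : sign_changes id = set0) //.
by apply/seteqP; split => n //=; rewrite /sign_changes /= eqxx.
Qed.

Definition asp_one : ASP := MkASP (Bijective (frefl id) (frefl id)) asp_one_sign.

Lemma asp_mul_sign (alpha beta : ASP) :
  finite_set (sign_changes (alpha \o beta)).
Proof.
have [g gK Kg] := asp_bij beta.
apply: (@sub_finite_set _ _
  (sign_changes beta `|` g @` sign_changes alpha)); last first.
  by rewrite finite_setU; split; [|apply: finite_image]; exact: asp_sign.
move=> n; rewrite /sign_changes /= => H.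
have [e|ne] := eqVneq (n < 0) (beta n < 0); last by left.
by right; exists (beta n); rewrite ?gK // -e.
Qed.

Definition asp_mul (alpha beta : ASP) : ASP :=
  MkASP (bij_comp (asp_bij alpha) (asp_bij beta)) (asp_mul_sign alpha beta).

Lemma asp_inv_subproof (alpha : ASP) :
  exists beta : ASP, cancel alpha beta /\ cancel beta alpha.
Proof.
have [g gK Kg] := asp_bij alpha.
have sg : finite_set (sign_changes g).
  apply: (@sub_finite_set _ _ (alpha @` sign_changes alpha)); last first.
    by apply: finite_image; exact: asp_sign.
  move=> n; rewrite /sign_changes /= => H.
  by exists (g n); rewrite Kg // eq_sym.
by exists (MkASP (Bijective Kg gK) sg).
Qed.

Definition asp_inv (alpha : ASP) : ASP := sval (cid (asp_inv_subproof alpha)).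

Lemma asp_funK (alpha : ASP) : cancel alpha (asp_inv alpha).
Proof. by rewrite /asp_inv; case: cid => g []. Qed.

Lemma asp_invK (alpha : ASP) : cancel (asp_inv alpha) alpha.
Proof. by rewrite /asp_inv; case: cid => g []. Qed.

Lemma asp_mulA : associative asp_mul.
Proof. by move=> a b c; apply: asp_ext. Qed.

Lemma asp_mul1 : left_id asp_one asp_mul.
Proof. by move=> a; apply: asp_ext. Qed.

Lemma asp_mulr1 : right_id asp_one asp_mul.
Proof. by move=> a; apply: asp_ext. Qed.

Lemma asp_mulV : left_inverse asp_one asp_inv asp_mul.
Proof. by move=> a; apply: asp_ext => n /=; rewrite asp_funK. Qed.

Lemma asp_mulrV : right_inverse asp_one asp_inv asp_mul.
Proof. by move=> a; apply: asp_ext => n /=; rewrite asp_invK. Qed.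

HB.instance Definition _ :=
  isGroup.Build ASP asp_mulA asp_mul1 asp_mulr1 asp_mulV asp_mulrV.

Lemma aspM (alpha beta : ASP) (n : int) : (alpha * beta)%g n = alpha (beta n).
Proof. by []. Qed.

Lemma aspK (alpha : ASP) : cancel alpha (alpha^-1)%g.
Proof. exact: asp_funK. Qed.

Lemma aspVK (alpha : ASP) : cancel (alpha^-1)%g alpha.
Proof. exact: asp_invK. Qed.

Definition inv_set (alpha : ASP) (a b : int) : set int :=
  [set n : int | b <= n /\ alpha n < a].

(* [fset_set A] is empty when [A] is infinite; see [finite_inv_set]. *)
Definition s (alpha : ASP) (a b : int) : nat :=
  #|` fset_set (inv_set alpha a b)|%fset.

Definition chi (alpha : ASP) : int :=
  (s alpha 0 0)%:Z - (s (alpha^-1)%g 0 0)%:Z.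

Definition bruhat (alpha beta : ASP) : Prop :=
  forall a b : int, (s alpha a b <= s beta a b)%N.

Definition bruhat_chi (alpha beta : ASP) : Prop :=
  bruhat alpha beta /\ chi alpha = chi beta.

Definition is_bruhat_min (A : set ASP) (gamma : ASP) : Prop :=
  A gamma /\ forall delta : ASP, A delta -> bruhat gamma delta.

Definition is_max (A : set int) (m : int) : Prop := A m /\ ubound A m.

Definition is_left_residual (alpha beta gamma : ASP) : Prop :=
  forall a b : int,
    is_max [set (s alpha a l)%:Z - (s (beta^-1)%g b l)%:Z | l in [set: int]]
           (s gamma a b)%:Z.

(* The defining property characterizes at most one element, by
   [is_left_residual_unique]; the default value 1 is never used since the
   left residual of two elements of [ASP] always exists. *)
Definition left_residual (alpha beta : ASP) : ASP :=
  xget 1%g [set gamma | is_left_residual alpha beta gamma].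

Lemma finite_int_itv (a b : int) : finite_set [set n : int | a <= n /\ n < b].
Proof.
apply: (@sub_finite_set _ _ ((fun k : nat => a + k%:Z) @` `I_(absz (b - a)))).
  move=> n /= [an nb]; exists (absz (n - a)); rewrite /=; lia.
by apply: finite_image; exact: finite_II.
Qed.

Lemma finite_inv_set (alpha : ASP) (a b : int) :
  finite_set (inv_set alpha a b).
Proof.
apply: (@sub_finite_set _ _ (sign_changes alpha `|`
  ([set n : int | b <= n /\ n < 0] `|`
   (alpha^-1)%g @` [set n : int | 0 <= n /\ n < a]))); last first.
  rewrite !finite_setU; split; first exact: asp_sign.
  by split; [|apply: finite_image]; exact: finite_int_itv.
move=> n [bn na]; rewrite /sign_changes /=.
have [n0|n0] := ltP n 0; first by right; left.
have [f0|f0] := ltP (alpha n) 0; first by left.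
by right; right; exists (alpha n); rewrite ?aspK.
Qed.

Lemma s_step (alpha : ASP) (a b : int) :
  s alpha a b = (s alpha a (b + 1) + (alpha b < a)%R)%N.
Proof.
rewrite /s; case: ltP => h; last first.
  rewrite addn0; congr (#|` fset_set _|%fset).
  apply/seteqP; split => n [bn na]; split => //; last lia.
  suff : n != b by lia.
  by apply: contraTneq na => ->; rewrite -leNgt.
have -> : inv_set alpha a b = b |` inv_set alpha a (b + 1).
  apply/seteqP; split => [n [bn na]|n [->|[bn na]]]; rewrite /inv_set /=.
  - by have [->|nb] := eqVneq n b; [left|right; split => //; lia].
  - by split.
  - by split => //; lia.
rewrite fset_setU1; last exact: finite_inv_set.
rewrite cardfsU1 in_fset_set; last exact: finite_inv_set.
rewrite (_ : (b \in inv_set _ _ _) = false) 1?addnC //=.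
by apply/negP; rewrite inE => -[]; lia.
Qed.

Lemma s_inj (alpha beta : ASP) :
  (forall a b : int, s alpha a b = s beta a b) -> alpha = beta.
Proof.
move=> e; apply: asp_ext => n.
have h a : (alpha n < a) = (beta n < a).
  have := s_step alpha a n; rewrite !e s_step.
  by case: (_ < a); case: (_ < a) => //; lia.
have := h (alpha n); have := h (beta n); rewrite !ltxx; lia.
Qed.

Lemma is_left_residual_unique (alpha beta gamma delta : ASP) :
  is_left_residual alpha beta gamma -> is_left_residual alpha beta delta ->
  gamma = delta.
Proof.
move=> hg hd; apply: s_inj => a b.
have [[g1 g2] [d1 d2]] := (hg a b, hd a b).
have := g2 _ d1; have := d2 _ g1; lia.
Qed.

(* Main.v *)
Require Import Defs.
From mathcomp Require Import all_boot all_order all_algebra.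
From mathcomp Require Import finmap boolp classical_sets cardinality.
From mathcomp Require Import zify.
Set Implicit Arguments.
Unset Strict Implicit.
Unset Printing Implicit Defensive.
Import Order.TTheory GRing.Theory Num.Theory.
Local Open Scope classical_set_scope.
Local Open Scope ring_scope.

(** Put [m(a, b) = max_l (s alpha a l - s beta b l)], the rank function of the
    left residual [gamma] of [alpha] and [beta^-1].

    Every product in the three sets lies above [gamma]. A point counted by
    [s alpha1 a l] has its [beta1]-image either below [b], so that it is counted
    by [s beta1 b l], or at least [b], so that its image is counted by
    [s (alpha1 * beta1^-1) a b]. Hence [s alpha1 a l - s beta1 b l] is at most
    [s (alpha1 * beta1^-1) a b] for each [l] ([s_mul_le]). Raising [alpha1] and
    lowering [beta1] only increases the left-hand side, so the bound holds with
    [alpha] and [beta] in their place; now maximize over [l]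
    ([residual_le_mul]).

    The residual exists because [m] looks like a rank function. It is
    supermodular in [(a, b)] ([residual_rank_superm]), it vanishes as soon as
    the sublevel set [{alpha < a}] is contained in [{beta < b}], and it equals
    [chi alpha - chi beta + a - b] as soon as the reverse inclusion holds. A
    function with these properties is the function [s] of some [gamma]
    ([asp_of_rank]): along each row and column its first differences form a
    0-1 step, and the positions of the steps define [gamma] and its inverse.

    The minima are attained because [alpha <= gamma * beta]
    ([residual_mul_ge]) and [gamma^-1 * alpha <= beta] ([residual_mul_le]):
    then [gamma] is both [(gamma * beta) * beta^-1] and
    [alpha * (gamma^-1 * alpha)^-1], and [chi] agrees because it is additive
    and [chi gamma = chi alpha - chi beta]. Both inequalities come from
    watching, with [l] restricted to [l >= l0], how the maximum changes when
    [b] or [a] moves by one. If [m] itself does not move, a maximizing [l] lies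
    to the right of the point where the step takes place; when that point is
    at least [l0], this maximizer is still allowed under the restriction, so
    the restricted maximum does not move either. Changes of [m] are recorded by
    [gamma], so the restricted maximum is bounded by a count of points
    expressed with [gamma] ([window]). *)

(** * Induction and monotone steps on the integers *)

Lemma int_ind_down (P : int -> Prop) :
  (exists b0 : int, forall b : int, b0 <= b -> P b) ->
  (forall b : int, P (b + 1) -> P b) ->
  forall b, P b.
Proof.
move=> [b0 P0] stp b.
have {P0} : P (b + (absz (b0 - b))%:Z) by apply: P0; lia.
elim: (absz _) => [|k IH]; first by rewrite addr0.
by move=> Pk; apply: IH; apply: stp; rewrite -addrA -PoszD addn1.
Qed.

Lemma int_ind_up (P : int -> Prop) :
  (exists a0 : int, forall a : int, a <= a0 -> P a) ->
  (forall a : int, P a -> P (a + 1)) ->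
  forall a, P a.
Proof.
move=> [a0 P0] stp a; rewrite -[a]opprK.
apply: (@int_ind_down (fun b => P (- b))).
  by exists (- a0) => b b0; apply: P0; lia.
by move=> b /stp; rewrite opprD subrK.
Qed.

Lemma int_const (f : int -> int) :
  (forall b : int, f (b + 1) = f b) -> forall b b', f b = f b'.
Proof.
move=> fS.
have up b (k : nat) : f (b + k%:Z) = f b.
  elim: k => [|k IH]; first by rewrite addr0.
  by rewrite -addn1 PoszD addrA fS.
move=> b b'; rewrite -(up b (absz (Num.max b b' - b))).
by rewrite -[RHS](up b' (absz (Num.max b b' - b'))); congr f; lia.
Qed.

Lemma int_mono (h : int -> int) :
  (forall a : int, h a <= h (a + 1)) -> forall a b : int, a <= b -> h a <= h b.
Proof.
move=> hS a b ab; have -> : b = a + (absz (b - a))%:Z by lia.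
elim: (absz _) => [|k IH]; first by rewrite addr0.
by apply: le_trans IH _; rewrite -addn1 PoszD addrA hS.
Qed.

(** The threshold [c] is the last place where [h] vanishes. *)
Lemma int_threshold (h : int -> int) :
  (forall a : int, h a <= h (a + 1)) ->
  (exists a0 : int, forall a : int, a <= a0 -> h a = 0) ->
  (exists a1 : int, forall a : int, a1 <= a -> h a = 1) ->
  exists c : int, forall a : int, h a = (c < a)%R.
Proof.
move=> /int_mono hmono [a0 h0] [a1 h1].
have h_ge0 a : 0 <= h a.
  by rewrite -(h0 (Num.min a a0)) ?hmono; lia.
have h_le1 a : h a <= 1.
  by rewrite -(h1 (Num.max a a1)) ?hmono; lia.
have ex : exists k : nat, h (a0 + k%:Z) != 0.
  by exists (absz (a1 - a0)); rewrite h1 //; lia.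
case: (ex_minnP ex) => -[|k] hk kmin; first by rewrite addr0 h0 in hk.
have hk0 : h (a0 + k%:Z) = 0.
  by have [//|/kmin] := eqVneq (h (a0 + k%:Z)) 0; lia.
exists (a0 + k%:Z) => a; have [ak|ak] := ltP (a0 + k%:Z) a.
  have := hmono (a0 + k.+1%:Z) a; have := h_ge0 (a0 + k.+1%:Z).
  by have := h_le1 a; lia.
by have := hmono _ _ ak; have := h_ge0 a; lia.
Qed.

(** * Counting finite sets of integers *)

Definition ncard (A : set int) : nat := #|` fset_set A|%fset.

Lemma ncard_sub A B : finite_set B -> A `<=` B -> (ncard A <= ncard B)%N.
Proof.
move=> fB AB; apply: fsubset_leq_card.
by rewrite -fset_set_sub //; exact: sub_finite_set fB.
Qed.

Lemma ncardU A B : finite_set A -> finite_set B ->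
  (ncard (A `|` B) <= ncard A + ncard B)%N.
Proof. by move=> fA fB; rewrite /ncard fset_setU // cardfsU leq_subr. Qed.

Lemma ncardU_disjoint A B : finite_set A -> finite_set B -> A `&` B = set0 ->
  ncard (A `|` B) = (ncard A + ncard B)%N.
Proof.
move=> fA fB AB; rewrite /ncard fset_setU // cardfsU -fset_setI // AB.
by rewrite fset_set0 cardfs0 subn0.
Qed.

Lemma ncard_image (alpha : ASP) A : finite_set A ->
  ncard (alpha @` A) = ncard A.
Proof.
move=> fA; rewrite /ncard fset_set_image // card_imfset //.
exact: can_inj (aspK alpha).
Qed.

Lemma ncard_step A x : finite_set A ->
  ncard A = (ncard (A `\ x) + (x \in A))%N.
Proof.
move=> fA; rewrite /ncard fset_setD1 // (cardfsD1 x (fset_set A)).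
by rewrite in_fset_set // addnC.
Qed.

Lemma finite_int_bounded (A : set int) : finite_set A ->
  exists K : int, forall n, A n -> - K < n < K.
Proof.
move=> fA; exists (\sum_(n <- fset_set A) (`|n| + 1)) => n An.
have nA : n \in fset_set A by rewrite in_fset_set // inE.
rewrite (big_fsetD1 n nA) /=; set S := (X in `|n| + 1 + X).
have : 0 <= S by apply: sumr_ge0 => i _; lia.
by move: S => S; lia.
Qed.

(** * The functions [s] and [chi] *)

Lemma s_ncard alpha a b : s alpha a b = ncard (inv_set alpha a b).
Proof. by []. Qed.

Lemma asp_lower_tail (alpha : ASP) (a : int) :
  exists L : int, forall n, L <= n -> a <= alpha n.
Proof.
have [K hK] := finite_int_bounded (finite_inv_set alpha a 0).
exists (Num.max 0 K) => n Kn; rewrite leNgt; apply/negP => na.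
have := hK n; rewrite /inv_set /=; lia.
Qed.

Lemma asp_upper_tail (alpha : ASP) (a : int) :
  exists L : int, forall n, n < L -> alpha n < a.
Proof.
have [K hK] := finite_int_bounded
  (finite_image (alpha^-1)%g (finite_inv_set (alpha^-1)%g 0 a)).
exists (Num.min 0 (- K)) => n Kn; rewrite ltNge; apply/negP => na.
have : - K < n < K; last lia.
by apply: hK; exists (alpha n); rewrite /inv_set /= ?aspK //; lia.
Qed.

(** Sublevel sets of any two almost sign-preserving permutations agree with
    half-lines up to finite sets, so either one contains the other once the
    levels are far enough apart. *)
Lemma sublevel_large (alpha beta : ASP) (b : int) :
  exists a0 : int, forall a : int, a0 <= a ->
    forall n : int, beta n < b -> alpha n < a.
Proof.
have [L hL] := asp_lower_tail beta b.
have [a0 ha] := asp_lower_tail (alpha^-1)%g L.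
exists a0 => a a0a n nb.
have nL : n < L by rewrite ltNge; apply/negP => /hL; lia.
rewrite ltNge; apply/negP => an; have := ha (alpha n); rewrite aspK; lia.
Qed.

Lemma sublevel_small (alpha beta : ASP) (a : int) :
  exists b0 : int, forall b : int, b <= b0 ->
    forall n : int, beta n < b -> alpha n < a.
Proof.
have [L hL] := asp_upper_tail alpha a.
have [b0 hb] := asp_upper_tail (beta^-1)%g L.
exists b0 => b b0b n nb; apply: hL; rewrite -(aspK beta n); apply: hb; lia.
Qed.

Lemma s_stepl (alpha : ASP) (a b : int) :
  s alpha (a + 1) b = (s alpha a b + (b <= (alpha^-1)%g a)%R)%N.
Proof.
rewrite !s_ncard (ncard_step ((alpha^-1)%g a)); last exact: finite_inv_set.
congr (ncard _ + nat_of_bool _)%N.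
  apply/seteqP; split => n.
    move=> [[bn na] /= nq]; split => //.
    suff : alpha n != a by lia.
    by apply/eqP => e; apply: nq; rewrite -e aspK.
  move=> [bn na]; split; first by split => //; lia.
  by move=> e; move: na; rewrite e aspVK ltxx.
by apply/idP/idP; rewrite inE /inv_set /= aspVK; [case|split=> //; lia].
Qed.

(** One unit step of [a] or of [b] changes both sides by the same amount, so
    the identity propagates from [(0, 0)], where it is the definition of
    [chi]. *)
Lemma s_diff (alpha : ASP) (a b : int) :
  (s alpha a b)%:Z = (s (alpha^-1)%g b a)%:Z + chi alpha + a - b.
Proof.
pose f (x y : int) : int := (s alpha x y)%:Z - (s (alpha^-1)%g y x)%:Z - x + y.
suff : f a b = f 0 0 by rewrite /f /chi; lia.
rewrite (@int_const (f a) _ b 0).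
  apply: (@int_const (f ^~ 0)) => x; rewrite /f /= s_stepl (s_step _ 0 x).
  by rewrite ltNge; case: (0 <= _)%R => /=; lia.
move=> y; rewrite /f (s_step _ a y) s_stepl invgK.
by rewrite ltNge; case: (a <= _)%R => /=; lia.
Qed.

Lemma s_eq0 (alpha : ASP) (a b : int) :
  (forall n, b <= n -> a <= alpha n) -> s alpha a b = 0%N.
Proof.
move=> h; rewrite s_ncard /ncard (_ : inv_set _ _ _ = set0).
  by rewrite fset_set0 cardfs0.
by apply/seteqP; split => n // -[/h]; lia.
Qed.

Lemma s_large (alpha : ASP) (a : int) :
  exists b0 : int, forall b : int, b0 <= b -> s alpha a b = 0%N.
Proof.
have [L hL] := asp_lower_tail alpha a.
by exists L => b Lb; apply: s_eq0 => n bn; apply: hL; lia.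
Qed.

Lemma s_small (alpha : ASP) (b : int) :
  exists a0 : int, forall a : int, a <= a0 -> s alpha a b = 0%N.
Proof.
have [L hL] := asp_upper_tail (alpha^-1)%g b.
exists L => a La; apply: s_eq0 => n bn; rewrite leNgt; apply/negP => na.
have := hL (alpha n); rewrite aspK; lia.
Qed.

(** Each [n] counted on the left is counted on the right by [s tau b c] when
    [tau n < b], and through its image [tau n] by [s sigma a b] otherwise. *)
Lemma s_mul_le (sigma tau : ASP) (a b c : int) :
  (s (sigma * tau)%g a c <= s sigma a b + s tau b c)%N.
Proof.
rewrite !s_ncard -(ncard_image (tau^-1)%g (finite_inv_set sigma a b)).
have f1 := finite_image (tau^-1)%g (finite_inv_set sigma a b).
apply: leq_trans (ncardU f1 (finite_inv_set _ _ _)).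
apply: ncard_sub.
  by rewrite finite_setU; split=> //; exact: finite_inv_set.
move=> n [cn na]; have [bn|bn] := ltP (tau n) b; [by right|left].
by exists (tau n); rewrite ?aspK.
Qed.

(** The inclusions of sublevel sets make the covering of [s_mul_le] an exact
    partition. *)
Lemma s_mul_eq (sigma tau : ASP) (a b c : int) :
  (forall m, m < b -> sigma m < a) -> (forall n, n < c -> tau n < b) ->
  s (sigma * tau)%g a c = (s sigma a b + s tau b c)%N.
Proof.
move=> h1 h2.
rewrite !s_ncard -(ncard_image (tau^-1)%g (finite_inv_set sigma a b)).
have f1 := finite_image (tau^-1)%g (finite_inv_set sigma a b).
rewrite -(ncardU_disjoint f1 (finite_inv_set _ _ _)).
  congr ncard; apply/seteqP; split => n.
    move=> [cn na]; have [bn|bn] := ltP (tau n) b; [by right|left].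
    by exists (tau n); rewrite ?aspK.
  move=> [[m [bm ma] <-]|[cn nb]]; split => //; rewrite ?aspM ?aspVK //.
    by rewrite leNgt; apply/negP => /h2; rewrite aspVK; lia.
  exact: h1.
by apply/seteqP; split => // n [[m [bm ma] <-] []]; rewrite aspVK; lia.
Qed.

(** By [s_diff], since the hypothesis leaves nothing for [s alpha^-1 b a] to
    count. This reads [chi] off a single value of [s]. *)
Lemma s_chi (alpha : ASP) (a b : int) : (forall n, n < b -> alpha n < a) ->
  (s alpha a b)%:Z = chi alpha + a - b.
Proof.
move=> h; rewrite s_diff s_eq0 ?add0r // => m am.
by rewrite leNgt; apply/negP => /h; rewrite aspVK; lia.
Qed.

(** Nested sublevel sets turn all three shifts into values of [s] through
    [s_chi], and those values add up by [s_mul_eq]. *)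
Lemma chiM (sigma tau : ASP) : chi (sigma * tau)%g = chi sigma + chi tau.
Proof.
have [a0 h1] := sublevel_large sigma 1%g 0.
have [c0 h2] := sublevel_small tau 1%g 0.
have {}h1 := h1 _ (lexx a0); have {}h2 := h2 _ (lexx c0).
have h12 n : n < c0 -> (sigma * tau)%g n < a0 by move=> /h2 /h1.
have := s_mul_eq h1 h2; have := s_chi h1; have := s_chi h2; have := s_chi h12.
lia.
Qed.

Lemma chiV (sigma : ASP) : chi (sigma^-1)%g = - chi sigma.
Proof. by rewrite /chi invgK; lia. Qed.

(** * Recognizing rank functions *)

(** Supermodularity says that [M a b - M a (b + 1)] is nondecreasing in [a]; it
    goes from 0 to 1, so it is the indicator of [g b < a] for some [g b].
    Likewise [M (a + 1) b - M a b] is the indicator of [b <= d a]. The mixed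
    second difference of [M] is then the indicator of both [g b = a] and
    [d a = b], which makes [g] and [d] mutually inverse. *)
Lemma asp_of_rank (M : int -> int -> nat) (chi0 : int) :
  (forall a b : int, (M a b)%:Z + (M (a + 1) (b + 1))%:Z <=
    (M (a + 1) b)%:Z + (M a (b + 1))%:Z) ->
  (forall b : int, exists a0 : int, forall a : int, a <= a0 -> M a b = 0%N) ->
  (forall a : int, exists b0 : int, forall b : int, b0 <= b -> M a b = 0%N) ->
  (forall b : int, exists a0 : int, forall a : int, a0 <= a ->
     (M a b)%:Z = chi0 + a - b) ->
  (forall a : int, exists b0 : int, forall b : int, b <= b0 ->
     (M a b)%:Z = chi0 + a - b) ->
  exists gamma : ASP, forall a b : int, s gamma a b = M a b.
Proof.
move=> supM M0a M0b Mxa Mxb.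
have exg (b : int) : exists c : int, forall a : int,
    (M a b)%:Z - (M a (b + 1))%:Z = (c < a)%R.
  apply: int_threshold => [a||].
  - by have := supM a b; lia.
  - have [a1 h1] := M0a b; have [a2 h2] := M0a (b + 1).
    by exists (Num.min a1 a2) => a la; rewrite h1 ?h2 //; lia.
  - have [a1 h1] := Mxa b; have [a2 h2] := Mxa (b + 1).
    by exists (Num.max a1 a2) => a la; rewrite h1 ?h2 //; lia.
have exd (a : int) : exists c : int, forall b : int,
    1 - ((M (a + 1) b)%:Z - (M a b)%:Z) = (c < b)%R.
  apply: int_threshold => [b||].
  - by have := supM a b; lia.
  - have [b1 h1] := Mxb (a + 1); have [b2 h2] := Mxb a.
    by exists (Num.min b1 b2) => b lb; rewrite h1 ?h2 //; lia.
  - have [b1 h1] := M0b (a + 1); have [b2 h2] := M0b a.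
    by exists (Num.max b1 b2) => b lb; rewrite h1 ?h2 //; lia.
have [g gE] := choice exg; have [d dE] := choice exd.
have gd (a b : int) : (g b == a) = (d a == b).
  have := gE b a; have := gE b (a + 1).
  have := dE a b; have := dE a (b + 1).
  case: (ltP (g b) a); case: (ltP (g b) (a + 1));
  case: (ltP (d a) b); case: (ltP (d a) (b + 1)); lia.
have gK : cancel g d by move=> b; apply/eqP; rewrite -gd.
have dK : cancel d g by move=> a; apply/eqP; rewrite gd.
(* The margin 1 below ensures that [n] and [n + 1] are both in the range where
   [M] is affine. *)
have gsign : finite_set (sign_changes g).
  have [b1 h1] := M0b 0; have [b2 h2] := Mxb 0.
  apply: sub_finite_set (finite_int_itv (Num.min b2 0 - 1) (Num.max b1 0)).
  move=> n; rewrite /sign_changes /=; have := gE n 0.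
  have [nb|nb] := leP (Num.max b1 0) n.
    rewrite !h1; [|lia|lia]; case: (g n < 0)%R => //=; lia.
  have [bn|bn] := ltP n (Num.min b2 0 - 1); last by lia.
  by rewrite !h2; [|lia|lia]; case: (g n < 0)%R => //=; lia.
pose gamma := MkASP (Bijective gK dK) gsign.
exists gamma => a; apply: int_ind_down => [|b IH].
  have [b1 h1] := M0b a; have [b2 h2] := s_large gamma a.
  by exists (Num.max b1 b2) => b lb; rewrite h1 ?h2 //; lia.
by rewrite s_step IH /=; have := gE b a; lia.
Qed.

(** * Existence of the residual *)

(** This says that [m] is the maximum over [l] of [s alpha a l - s beta b l],
    without leaving the natural numbers. *)
Definition residual_rank (alpha beta : ASP) (a b : int) (m : nat) : Prop :=
  (forall l : int, (s alpha a l <= m + s beta b l)%N) /\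
  exists l : int, (s alpha a l = m + s beta b l)%N.

Definition residual (alpha beta gamma : ASP) : Prop :=
  forall a b : int, residual_rank alpha beta a b (s gamma a b).

(** The least upper bound is attained: if positive, because it cannot be lowered
    by one; if zero, because both terms vanish for large [l]. *)
Lemma residual_rank_ex (alpha beta : ASP) (a b : int) :
  exists m, residual_rank alpha beta a b m.
Proof.
have ex : exists m, `[<forall l : int, (s alpha a l <= m + s beta b l)%N>].
  exists (s (alpha * beta^-1)%g a b); apply/asboolP => l.
  by have := s_mul_le (alpha * beta^-1)%g beta a b l; rewrite mulgVK.
case: (ex_minnP ex) => m /asboolP hm mmin; exists m; split=> //.
case: m hm mmin => [|m] hm mmin.
  have [l1 h1] := s_large alpha a; have [l2 h2] := s_large beta b.
  by exists (Num.max l1 l2); rewrite h1 ?h2 //; lia.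
have /existsNP [l hl] : ~ forall l : int, (s alpha a l <= m + s beta b l)%N.
  by move=> h; have := mmin m; rewrite (asboolT h) ltnn => /(_ isT).
by exists l; have := hm l; lia.
Qed.

Lemma residual_rank_eq0 (alpha beta : ASP) (a b : int) (m : nat) :
  (forall n : int, alpha n < a -> beta n < b) ->
  residual_rank alpha beta a b m -> m = 0%N.
Proof.
move=> h [_ [l hl]].
suff : (s alpha a l <= s beta b l)%N by lia.
by apply: ncard_sub (finite_inv_set _ _ _) _ => n [ln /h].
Qed.

(** By [s_diff] the difference [s alpha a l - s beta b l] is the claimed value
    plus [s alpha^-1 l a - s beta^-1 l b]. The latter is nonpositive because
    [alpha n >= a] implies [beta n >= b], and it vanishes for [l] very
    negative. *)
Lemma residual_rank_chi (alpha beta : ASP) (a b : int) (m : nat) :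
  (forall n : int, beta n < b -> alpha n < a) ->
  residual_rank alpha beta a b m -> m%:Z = chi alpha - chi beta + a - b.
Proof.
move=> h [hm [l hl]].
have [L1 h1] := asp_upper_tail alpha a; have [L2 h2] := asp_upper_tail beta b.
pose L := Num.min L1 L2.
have e1 : (s alpha a L)%:Z = chi alpha + a - L.
  by apply: s_chi => n nL; apply: h1; lia.
have e2 : (s beta b L)%:Z = chi beta + b - L.
  by apply: s_chi => n nL; apply: h2; lia.
have le : (s (alpha^-1)%g l a <= s (beta^-1)%g l b)%N.
  rewrite !s_ncard.
  rewrite -(ncard_image (alpha^-1)%g (finite_inv_set (alpha^-1)%g l a)).
  rewrite -(ncard_image (beta^-1)%g (finite_inv_set (beta^-1)%g l b)).
  apply: ncard_sub; first exact/finite_image/finite_inv_set.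
  move=> _ [k [ak kl] <-]; exists (beta ((alpha^-1)%g k)); last by rewrite aspK.
  split; last by rewrite aspK.
  by rewrite leNgt; apply/negP => /h; rewrite aspVK; lia.
have := s_diff alpha a l; have := s_diff beta b l; have := hm L; lia.
Qed.

(** Let [l1] and [l2] be maximizers at [(a, b)] and [(a + 1, b + 1)]. Among
    [(a + 1, b)] and [(a, b + 1)], use the smaller of them at the former and the
    larger at the latter: the unit step in [a] adds the indicator of
    [l <= alpha^-1 a], the unit step in [b] subtracts that of [l <= beta^-1 b],
    and these indicators are nonincreasing in [l]. *)
Lemma residual_rank_superm (alpha beta : ASP) (M : int -> int -> nat) :
  (forall a b, residual_rank alpha beta a b (M a b)) ->
  forall a b : int, (M a b)%:Z + (M (a + 1) (b + 1))%:Z <=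
    (M (a + 1) b)%:Z + (M a (b + 1))%:Z.
Proof.
move=> hM a b.
have [_ [l1 e1]] := hM a b; have [_ [l2 e2]] := hM (a + 1) (b + 1).
have [h1 _] := hM (a + 1) b; have [h2 _] := hM a (b + 1).
have [l12|/ltW l21] := leP l1 l2.
  have := h1 l1; have := h2 l2.
  have := s_stepl alpha a l1; have := s_stepl alpha a l2.
  have /implyP := @le_trans _ _ l2 l1 ((alpha^-1)%g a) l12.
  by case: (l1 <= _)%R; case: (l2 <= _)%R => //= _; lia.
have := h1 l2; have := h2 l1.
have := s_stepl beta b l1; have := s_stepl beta b l2.
have /implyP := @le_trans _ _ l1 l2 ((beta^-1)%g b) l21.
by case: (l1 <= _)%R; case: (l2 <= _)%R => //= _; lia.
Qed.

Lemma residual_ex (alpha beta : ASP) :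
  exists gamma : ASP, residual alpha beta gamma.
Proof.
have [M hM] :=
  choice (fun ab : int * int => residual_rank_ex alpha beta ab.1 ab.2).
have {}hM a b : residual_rank alpha beta a b (M (a, b)) by exact: (hM (a, b)).
have [|b|a|b|a|gamma hg] :=
  @asp_of_rank (fun a b => M (a, b)) (chi alpha - chi beta).
- exact: residual_rank_superm hM.
- have [a0 ha] := sublevel_small beta alpha b.
  by exists a0 => a /ha h; apply: residual_rank_eq0 h (hM a b).
- have [b0 hb] := sublevel_large beta alpha a.
  by exists b0 => b /hb h; apply: residual_rank_eq0 h (hM a b).
- have [a0 ha] := sublevel_large alpha beta b.
  by exists a0 => a /ha h; apply: residual_rank_chi h (hM a b).
- have [b0 hb] := sublevel_small alpha beta a.
  by exists b0 => b /hb h; apply: residual_rank_chi h (hM a b).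
by exists gamma => a b; rewrite hg.
Qed.

(** * Minimality of the residual *)

Lemma residual_chi (alpha beta gamma : ASP) :
  residual alpha beta gamma -> chi gamma = chi alpha - chi beta.
Proof.
move=> gammaP.
have [a0 ha] := sublevel_large gamma 1%g 0.
have [a1 hb] := sublevel_large alpha beta 0.
have := s_chi (ha (Num.max a0 a1) _).
have := residual_rank_chi (hb (Num.max a0 a1) _) (gammaP _ _).
lia.
Qed.

(** Evaluate [s_mul_le] at the [l] realizing the maximum for [gamma]. *)
Lemma residual_le_mul (alpha beta gamma alpha1 beta1 : ASP) :
  residual alpha beta gamma -> bruhat alpha alpha1 -> bruhat beta1 beta ->
  bruhat gamma (alpha1 * beta1^-1)%g.
Proof.
move=> gammaP ha hb a b; have [_ [l e]] := gammaP a b.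
have := s_mul_le (alpha1 * beta1^-1)%g beta1 a b l; rewrite mulgVK.
have := ha a l; have := hb b l; lia.
Qed.

(** Used with [sigma = gamma * tau]. It exhausts the set counted by
    [s sigma a l] as [b] decreases, and [{n >= l | b <= tau n}] as [a]
    increases. *)
Definition window (sigma tau : ASP) (l a b : int) : set int :=
  [set n | [/\ l <= n, sigma n < a & b <= tau n]].

Lemma finite_window (sigma tau : ASP) (l a b : int) :
  finite_set (window sigma tau l a b).
Proof. by apply: sub_finite_set (finite_inv_set sigma a l) => n []. Qed.

Lemma window_stepr (sigma tau : ASP) (l a b : int) :
  ncard (window sigma tau l a b) =
  (ncard (window sigma tau l a (b + 1)) +
    (l <= (tau^-1)%g b)%R && (sigma ((tau^-1)%g b) < a)%R)%N.
Proof.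
rewrite (ncard_step ((tau^-1)%g b)); last exact: finite_window.
congr (ncard _ + nat_of_bool _)%N.
  apply/seteqP; split => n.
    move=> [[ln na bn] /= nq]; split => //.
    suff : tau n != b by lia.
    by apply/eqP => e; apply: nq; rewrite -e aspK.
  move=> [ln na bn]; split; first by split => //; lia.
  by move=> e; move: bn; rewrite e aspVK; lia.
apply/idP/andP; rewrite inE /window /= aspVK; first by case.
by case.
Qed.

Lemma window_stepl (sigma tau : ASP) (l a b : int) :
  ncard (window sigma tau l (a + 1) b) =
  (ncard (window sigma tau l a b) +
    (l <= (sigma^-1)%g a)%R && (b <= tau ((sigma^-1)%g a))%R)%N.
Proof.
rewrite (ncard_step ((sigma^-1)%g a)); last exact: finite_window.
congr (ncard _ + nat_of_bool _)%N.
  apply/seteqP; split => n.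
    move=> [[ln na bn] /= nq]; split => //.
    suff : sigma n != a by lia.
    by apply/eqP => e; apply: nq; rewrite -e aspK.
  move=> [ln na bn]; split; first by split => //; lia.
  by move=> e; move: na; rewrite e aspVK; lia.
apply/idP/andP; rewrite inE /window /= aspVK; first by case.
by case=> ln bn; split=> //; lia.
Qed.

(** The restricted maximum over [l >= l0] of [s alpha a l - s beta b l] is at
    most the size of the window, by descending induction on [b]. At the step
    from [b + 1] to [b] the point concerned is [p = beta^-1 b]. If [p >= l0] but
    [p] does not enter the window, then [gamma b >= a], so the unrestricted
    maximum is the same at [b] and [b + 1]. A maximizer [l'] at [b + 1]
    satisfies [l' > p], since otherwise the step would raise it; hence
    [l' >= l0] and the induction hypothesis applies to [l']. Taking [b] very
    negative and [l = l0] gives the statement. *)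
Lemma residual_mul_ge (alpha beta gamma : ASP) :
  residual alpha beta gamma -> bruhat alpha (gamma * beta)%g.
Proof.
move=> gammaP a l0.
suff C b : forall l, l0 <= l ->
    (s alpha a l <= ncard (window (gamma * beta)%g beta l0 a b) + s beta b l)%N.
  have [b0 hb] := s_small beta l0.
  have := C b0 l0 (lexx l0); rewrite hb // addn0 => /leq_trans; apply.
  by apply: ncard_sub (finite_inv_set _ _ _) _ => n [].
move: b; apply: int_ind_down => [|b IH l l0l].
  have [b0 hb] := sublevel_large beta alpha a; exists b0 => b b0b l l0l.
  apply: leq_trans (leq_addl _ _).
  by apply: ncard_sub (finite_inv_set _ _ _) _ => n [ln /(hb _ b0b)].
rewrite window_stepr aspM aspVK.
have st := s_stepl beta b.
have [pl|lp] := ltP ((beta^-1)%g b) l.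
  by have := IH l l0l; have := st l; lia.
have [ga|ga] := ltP (gamma b) a.
  by have := IH l l0l; have := st l; rewrite lp (le_trans l0l lp) /=; lia.
have [_ [l' e']] := gammaP a (b + 1); have [h _] := gammaP a b.
have := s_step gamma a b; rewrite (ltNge (gamma b)) ga /= => sg.
have := h l; have := h l'; have := st l'.
have [pl'|lp'] := ltP ((beta^-1)%g b) l'; last by lia.
by have := IH l'; lia.
Qed.

(** The same bound on the restricted maximum, now by ascending induction on [a],
    the step from [a] to [a + 1] taking place at [alpha^-1 a]. For large [a] the
    points counted by [s alpha a l0] are those of the window together with those
    counted by [s (gamma^-1 * alpha) b l0], which turns the bound into the
    statement. *)
Lemma residual_mul_le (alpha beta gamma : ASP) :
  residual alpha beta gamma -> bruhat (gamma^-1 * alpha)%g beta.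
Proof.
move=> gammaP b l0.
suff C a : forall l, l0 <= l ->
    (s alpha a l <=
      ncard (window alpha (gamma^-1 * alpha)%g l0 a b) + s beta b l)%N.
  have [a0 ha] := sublevel_large alpha (gamma^-1 * alpha)%g b.
  have := C a0 l0 (lexx l0).
  rewrite s_ncard (_ : inv_set alpha a0 l0 = inv_set (gamma^-1 * alpha)%g b l0
    `|` window alpha (gamma^-1 * alpha)%g l0 a0 b).
    rewrite (ncardU_disjoint (finite_inv_set _ _ _) (finite_window _ _ _ _ _)).
      by rewrite -s_ncard addnC leq_add2l.
    by apply/seteqP; split => // n [[]] + + []; lia.
  apply/seteqP; split=> n.
    move=> [ln na].
    by have [bn|bn] := ltP ((gamma^-1 * alpha)%g n) b; [left|right].
  by case=> [[ln /(ha _ (lexx a0))]|[]].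
move: a; apply: int_ind_up => [|a IH l l0l].
  have [a0 ha] := sublevel_small beta alpha b; exists a0 => a aa0 l l0l.
  apply: leq_trans (leq_addl _ _).
  by apply: ncard_sub (finite_inv_set _ _ _) _ => n [ln /(ha _ aa0)].
rewrite window_stepl aspM aspVK.
have st := s_stepl alpha a.
have [ql|lq] := ltP ((alpha^-1)%g a) l.
  by have := IH l l0l; have := st l; lia.
have [gb|gb] := leP b ((gamma^-1)%g a).
  by have := IH l l0l; have := st l; rewrite lq (le_trans l0l lq) /=; lia.
have [_ [l' e']] := gammaP a b; have [h _] := gammaP (a + 1) b.
have := s_stepl gamma a b; rewrite (leNgt b) gb /= => sg.
have := h l; have := h l'; have := st l'; have := st l.
have [ql'|lq'] := ltP ((alpha^-1)%g a) l'; last by lia.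
by have := IH l'; lia.
Qed.

Theorem theorem6p1 (alpha beta : ASP) :
  is_bruhat_min
    [set (alpha1 * beta1^-1)%g | alpha1 in [set alpha1 | bruhat alpha alpha1]
                               & beta1 in [set beta1 | bruhat beta1 beta]]
    (left_residual alpha (beta^-1)%g) /\
  is_bruhat_min
    [set (alpha * beta1^-1)%g | beta1 in [set beta1 | bruhat_chi beta1 beta]]
    (left_residual alpha (beta^-1)%g) /\
  is_bruhat_min
    [set (alpha1 * beta^-1)%g | alpha1 in [set alpha1 | bruhat_chi alpha alpha1]]
    (left_residual alpha (beta^-1)%g).
Proof.
have [gamma gammaP] := residual_ex alpha beta.
have gammaR : is_left_residual alpha (beta^-1)%g gamma.
  move=> a b; have [h [l e]] := gammaP a b.
  split=> [|_ [k _ <-]]; first by exists l => //; rewrite invgK; lia.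
  by have := h k; rewrite invgK; lia.
have -> : left_residual alpha (beta^-1)%g = gamma.
  have ex : [set delta | is_left_residual alpha (beta^-1)%g delta] !=set0.
    by exists gamma.
  exact: is_left_residual_unique (xgetPex 1%g ex) gammaR.
have chi_gamma := residual_chi gammaP.
have refl delta : bruhat delta delta by move=> a b.
have alphaK : (alpha * (gamma^-1 * alpha)^-1)%g = gamma.
  by rewrite invgM invgK mulgA mulgV mul1g.
split; last split; split.
- exists alpha; first exact: refl.
  by exists (gamma^-1 * alpha)%g; [exact: residual_mul_le|].
- by move=> _ [alpha1 ha [beta1 hb <-]]; apply: residual_le_mul.
- exists (gamma^-1 * alpha)%g => //; split; first exact: residual_mul_le.
  by rewrite chiM chiV chi_gamma; lia.
- by move=> _ [beta1 [hb _] <-]; apply: residual_le_mul.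
- exists (gamma * beta)%g; last by rewrite mulgK.
  by split; [exact: residual_mul_ge|rewrite chiM chi_gamma; lia].
- by move=> _ [alpha1 [ha _] <-]; apply: residual_le_mul.
Qed.
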